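(* Let $X$ be a nonempty completely regular space, $\mu$ a Borel measure on $X$ with support equal to the whole of $X$, $E\neq\{0\}$ a Banach space and $D=L^\infty_\mu(X,E)$. Let $A=C(X,L(E))\subset L(D)$ act by multiplication, $(af)(x)=a(x)f(x)$. Let $G$ be a discrete group, $\{t_g\}_{g\in G}$ a group of homeomorphisms of $X$ ($t_{gh}=t_g\circ t_h$) preserving the equivalence class of $\mu$, and let $T_g$ be the isometry of $D$ given by $(T_gf)(x)=f(t_g^{-1}(x))$. If $G$ acts topologically freely on $X$, then for every nonempty finite $F\subset G$ and all $a_g\in A$ ($g\in F$) $$\Big\|\sum_{g\in F}a_gT_g\Big\|=\sup_{x\in X}\ \sup_{\{f_g\}_{g\in F}\in S_F(E)}\Big\|\sum_{g\in F}a_g(x)f_g\Big\|=\sup_{x\in X}\ \sup_{\{f_g\}_{g\in F}\in B_F(E)}\Big\|\sum_{g\in F}a_g(x)f_g\Big\|,$$ where the norm on the left is the operator norm in $L(D)$.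
   Context: All Banach spaces are complex, completely regular spaces are Hausdorff. $L(E)$ is the algebra of bounded linear operators on $E$; $C(X,B)$ is the space of bounded continuous functions $X\to B$ with the sup norm. Preserving the equivalence class of $\mu$ means that for each $g\in G$ the measure $Q\mapsto\mu(t_g^{-1}(Q))$ is absolutely continuous with respect to $\mu$. For a finite set $F\subset G$: $B_F(E)=\{\{f_g\}_{g\in F}: f_g\in E,\ \|f_g\|\le1 \text{ for all } g\in F\}$ and $S_F(E)=\{\{f_g\}_{g\in F}: f_g\in E,\ \|f_g\|=1\text{ for all } g\in F\}$. $G$ acts topologically freely if for every $g\in G$, $g\neq e$, the set $\{x\in X:t_g(x)=x\}$ has empty interior. *)

(* Defs.v *)
From HB Require Import structures.
From mathcomp Require Import all_boot all_order all_algebra finmap.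
From mathcomp Require Import complex.
From mathcomp Require Import all_classical all_reals all_analysis.
From mathcomp Require Import ess_sup_inf.

Set Implicit Arguments.
Unset Strict Implicit.
Unset Printing Implicit Defensive.

Import Order.TTheory GRing.Theory Num.Theory.
Import numFieldNormedType.Exports.

Local Open Scope classical_set_scope.
Local Open Scope ring_scope.

(* Norms of normed modules over R[i] take their values in R[i]; the value is
   always of the form r%:C with r >= 0, and rnorm is that real number r. *)
Definition rnorm (R : realType) (V : normedModType R[i]) (v : V) : R :=
  complex.Re `|v|.

Lemma Re_normE (R : realType) (k : R[i]) : (complex.Re `|k|)%:C%C = `|k|.
Proof.
have /ger0_Im := normr_ge0 k.
by case: `|k| => a b /= ->.
Qed.

Lemma Re_norm_ge0 (R : realType) (k : R[i]) : 0 <= complex.Re `|k|.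
Proof. by rewrite -lecR Re_normE normr_ge0. Qed.

Section rnorm_theory.
Context {R : realType} {V : normedModType R[i]}.
Implicit Types v w : V.

Lemma rnormE v : (rnorm v)%:C%C = `|v|.
Proof.
have /ger0_Im := normr_ge0 v; rewrite /rnorm.
by case: `|v| => a b /= ->.
Qed.

Lemma rnorm_ge0 v : 0 <= rnorm v.
Proof. by rewrite -lecR rnormE normr_ge0. Qed.

Lemma rnorm0 : rnorm (0 : V) = 0.
Proof. by rewrite /rnorm normr0. Qed.

Lemma rnorm0_eq0 v : rnorm v = 0 -> v = 0.
Proof. by move=> v0; apply/normr0_eq0; rewrite -rnormE v0. Qed.

Lemma rnormD v w : rnorm (v + w) <= rnorm v + rnorm w.
Proof. by rewrite -lecR rmorphD /= !rnormE ler_normD. Qed.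

Lemma rnormZ (k : R[i]) v : rnorm (k *: v) = complex.Re `|k| * rnorm v.
Proof.
by apply: (@complexI R); rewrite rmorphM /= !rnormE normrZ Re_normE.
Qed.

End rnorm_theory.

Record bounded_operator (R : realType) (V W : normedModType R[i]) :=
  BoundedOperator {
    bo_fun :> V -> W;
    bo_linear : linear bo_fun;
    bo_bounded : exists M : R, forall v, rnorm (bo_fun v) <= M * rnorm v
  }.

Section bounded_operator_normedModType.
Context {R : realType} {V W : normedModType R[i]}.
Local Notation L := (bounded_operator V W).
Implicit Types S T : L.

Lemma bo_ext S T : (S : V -> W) =1 T -> S = T.
Proof.
case: S T => [f lf bf] [g lg bg] /= /funext fg.
by subst g; congr BoundedOperator; exact: Prop_irrelevance.
Qed.

HB.instance Definition _ := gen_eqMixin L.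
HB.instance Definition _ := gen_choiceMixin L.

Let zero_linear : linear (fun _ : V => 0 : W).
Proof. by move=> k u v; rewrite scaler0 addr0. Qed.

Let zero_bounded : exists M : R, forall v : V, rnorm (0 : W) <= M * rnorm v.
Proof. by exists 0 => v; rewrite rnorm0 mul0r. Qed.

Definition bo_zero := BoundedOperator zero_linear zero_bounded.

Let add_linear S T : linear (fun v => S v + T v).
Proof.
move=> k u v; rewrite !bo_linear scalerDr.
by rewrite -!addrA; congr (_ + _); rewrite addrCA.
Qed.

Let add_bounded S T :
  exists M : R, forall v, rnorm (S v + T v) <= M * rnorm v.
Proof.
have [M SM] := bo_bounded S; have [N TN] := bo_bounded T.
exists (M + N) => v; rewrite mulrDl.
by rewrite (le_trans (rnormD _ _))// lerD.
Qed.

Definition bo_add S T := BoundedOperator (add_linear S T) (add_bounded S T).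

Let scale_linear (k : R[i]) T : linear (fun v => k *: T v).
Proof.
by move=> l u v; rewrite bo_linear scalerDr !scalerA mulrC.
Qed.

Let scale_bounded (k : R[i]) T :
  exists M : R, forall v, rnorm (k *: T v) <= M * rnorm v.
Proof.
have [M TM] := bo_bounded T; exists (complex.Re `|k| * M) => v.
by rewrite rnormZ -mulrA ler_wpM2l// Re_norm_ge0.
Qed.

Definition bo_scale (k : R[i]) T :=
  BoundedOperator (scale_linear k T) (scale_bounded k T).

Definition bo_opp T := bo_scale (-1) T.

Let bo_addA : associative bo_add.
Proof. by move=> S T U; apply: bo_ext => v /=; rewrite addrA. Qed.

Let bo_addC : commutative bo_add.
Proof. by move=> S T; apply: bo_ext => v /=; rewrite addrC. Qed.

Let bo_add0 : left_id bo_zero bo_add.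
Proof. by move=> S; apply: bo_ext => v /=; rewrite add0r. Qed.

Let bo_addN : left_inverse bo_zero bo_opp bo_add.
Proof. by move=> S; apply: bo_ext => v /=; rewrite scaleN1r addNr. Qed.

HB.instance Definition _ := GRing.isZmodule.Build L
  bo_addA bo_addC bo_add0 bo_addN.

Let bo_scaleA k l T : bo_scale k (bo_scale l T) = bo_scale (k * l) T.
Proof. by apply: bo_ext => v /=; rewrite scalerA. Qed.

Let bo_scale1 : left_id 1 bo_scale.
Proof. by move=> S; apply: bo_ext => v /=; rewrite scale1r. Qed.

Let bo_scaleDr : right_distributive bo_scale +%R.
Proof. by move=> k S T; apply: bo_ext => v /=; rewrite scalerDr. Qed.

Let bo_scaleDl T : {morph bo_scale^~ T : k l / k + l}.
Proof. by move=> k l; apply: bo_ext => v /=; rewrite scalerDl. Qed.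

HB.instance Definition _ := GRing.Zmodule_isLmodule.Build R[i] L
  bo_scaleA bo_scale1 bo_scaleDr bo_scaleDl.

Definition operator_norm (T : L) : R :=
  sup [set rnorm (T v) | v in [set v | rnorm v <= 1]].

Let img T : set R := [set rnorm (T v) | v in [set v | rnorm v <= 1]].

Let img_has_sup T : has_sup (img T).
Proof.
split.
  by exists (rnorm (T 0)); exists 0 => //=; rewrite rnorm0.
have [M TM] := bo_bounded T; exists `|M| => _ [v /= v1 <-].
rewrite (le_trans (TM v))//.
rewrite (le_trans (ler_norm _))// normrM (ger0_norm (rnorm_ge0 v)).
by rewrite ler_piMr.
Qed.

Lemma rnorm_le_operator_norm T v : rnorm v <= 1 -> rnorm (T v) <= operator_norm T.
Proof.
move=> v1; apply: sup_upper_bound; first exact: img_has_sup.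
by exists v.
Qed.

Lemma bo_scaleE (k : R[i]) T v : T (k *: v) = k *: T v.
Proof.
have T0 : T 0 = 0.
  have := bo_linear T 1 0 0; rewrite scaler0 addr0 scale1r => /eqP.
  by rewrite -subr_eq subrr eq_sym => /eqP.
by have := bo_linear T k v 0; rewrite !addr0 T0 addr0.
Qed.

Let operator_normD S T :
  (operator_norm (S + T : L))%:C%C <=
  (operator_norm S)%:C%C + (operator_norm T)%:C%C.
Proof.
rewrite -rmorphD lecR; apply: ge_sup; first by have [] := img_has_sup (S + T).
move=> _ [v /= v1 <-].
by rewrite (le_trans (rnormD _ _))// lerD// rnorm_le_operator_norm.
Qed.

Let operator_normZ_le (k : R[i]) T :
  operator_norm (k *: T : L) <= complex.Re `|k| * operator_norm T.
Proof.
apply: ge_sup; first by have [] := img_has_sup (k *: T).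
move=> _ [v /= v1 <-]; rewrite rnormZ ler_wpM2l ?Re_norm_ge0//.
exact: rnorm_le_operator_norm.
Qed.

Let operator_normZ (k : R[i]) T :
  (operator_norm (k *: T : L))%:C%C = `|k| * (operator_norm T)%:C%C.
Proof.
rewrite -Re_normE -rmorphM; congr (_ %:C%C).
apply/eqP; rewrite eq_le operator_normZ_le andTb.
have [->|k0] := eqVneq k 0.
  rewrite (_ : complex.Re `|0| = 0); last by apply: (@complexI R); rewrite Re_normE normr0.
  rewrite mul0r (le_trans (rnorm_ge0 ((0 *: T : L) 0)))//.
  by rewrite rnorm_le_operator_norm// rnorm0.
have := operator_normZ_le k^-1 (k *: T).
rewrite scalerA mulVf// scale1r => /(ler_wpM2l (Re_norm_ge0 k)) /le_trans; apply.
rewrite mulrA (_ : complex.Re `|k| * complex.Re `|k^-1| = 1) ?mul1r//.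
by apply: (@complexI R); rewrite rmorphM /= !Re_normE -normrM mulfV// normr1.
Qed.

Let operator_norm_eq0 T : (operator_norm T)%:C%C = 0 -> T = 0.
Proof.
move=> /complexI T0; apply: bo_ext => v; apply: rnorm0_eq0.
have [->|v0] := eqVneq v 0.
  by rewrite -(scale0r (0 : V)) bo_scaleE scale0r rnorm0.
have nv0 : `|v| != 0 by rewrite normr_eq0.
have : rnorm (T (`|v|^-1 *: v)) <= 0.
  rewrite -T0 rnorm_le_operator_norm// rnormZ -lecR rmorphM /= Re_normE rnormE.
  by rewrite normfV normr_id mulVf.
rewrite bo_scaleE rnormZ => H; apply/eqP; rewrite eq_le rnorm_ge0 andbT.
rewrite pmulr_rle0 in H => //.
by rewrite -ltcR Re_normE normr_gt0 invr_neq0.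
Qed.

HB.instance Definition _ := Lmodule_isNormed.Build R[i] L
  operator_normD operator_normZ operator_norm_eq0.

Lemma rnorm_operatorE T : rnorm T = operator_norm T.
Proof. by []. Qed.

End bounded_operator_normedModType.

(* C(X, B). *)
Definition bounded_continuous (K : numFieldType) (X : topologicalType)
    (B : normedModType K) : set (X -> B) :=
  [set a | continuous a /\ bounded_fun a].

Record homeo (X : topologicalType) := Homeo {
  homeo_fun :> X -> X;
  homeo_inv : X -> X;
  homeo_funK : cancel homeo_fun homeo_inv;
  homeo_invK : cancel homeo_inv homeo_fun;
  homeo_fun_continuous : continuous homeo_fun;
  homeo_inv_continuous : continuous homeo_inv
}.

(* ptopologicalType is the library's type of nonempty topological spaces: it
   only adds an arbitrary base point, which a measurableType must have. *)
Notation borelType X := (g_sigma_algebraType (@open X)).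

Definition measure_support (R : realType) (X : ptopologicalType)
    (mu : set (borelType X) -> \bar R) : set X :=
  [set x | forall U : set X, open U -> U x -> (0 < mu U)%E].

Section Linfty.
Context {R : realType} {X : ptopologicalType} {E : normedModType R[i]}.
Variable mu : {measure set (borelType X) -> \bar R}.
Implicit Type f : X -> E.

(* Bochner measurability; no restriction is put on the measures of the level
   sets of the simple functions, since mu need not be finite. *)
Definition strongly_measurable f :=
  exists s : nat -> {fimfun borelType X >-> E},
    (forall n e, measurable (s n @^-1` [set e])) /\
    \forall x \ae mu, s n x @[n --> \oo] --> f x.

Definition Linfty_norm f : \bar R := ess_sup mu (fun x => (rnorm (f x))%:E).

(* As for the Lfun of the library, the elements of L^oo are represented by
   functions, which are to be identified when they are equal mu-a.e. *)
Definition Linfty : set (X -> E) :=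
  [set f | strongly_measurable f /\ (Linfty_norm f < +oo)%E].

(* The operator norm on D = L^oo. The image S f enters only through its
   essential supremum norm, so that Linfty_opnorm S is also meaningful when
   the values of S are essentially bounded functions that are not Bochner
   measurable. (When X, L(E) and mu are large, the product of a Bochner
   measurable function by a continuous operator-valued function may fail to be
   essentially separably valued.) *)
Definition Linfty_opnorm (S : (X -> E) -> (X -> E)) : \bar R :=
  ereal_sup [set Linfty_norm (S f) |
              f in [set f | Linfty f /\ (Linfty_norm f <= 1)%E]].

#[local] Instance borel_ae_filter : Filter (almost_everywhere mu).
Proof. exact: ae_filter_ringOfSetsType. Qed.

Lemma Linfty_norm_ae_eq f1 f2 :
  (\forall x \ae mu, f1 x = f2 x) -> Linfty_norm f1 = Linfty_norm f2.
Proof. by move=> f12; apply: eq_ess_sup; apply: filterS f12 => x ->. Qed.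

Lemma Linfty_ae_eq f1 f2 :
  (\forall x \ae mu, f1 x = f2 x) -> Linfty f1 -> Linfty f2.
Proof.
move=> f12 [[s [ms sf1]] f1oo]; split; last by rewrite -(Linfty_norm_ae_eq f12).
by exists s; split => //; apply: filterS2 f12 sf1 => x ->.
Qed.

End Linfty.

Definition multiplication (R : realType) (X : Type) (E : normedModType R[i])
    (a : X -> bounded_operator E E) (f : X -> E) : X -> E :=
  fun x => a x (f x).

Definition translation (X : topologicalType) (Y : Type) (t : homeo X)
    (f : X -> Y) : X -> Y :=
  fun x => f (homeo_inv t x).

Section group_action.
Context {G : groupType} {X : topologicalType}.
Variable t : G -> homeo X.

Definition homeo_action := forall g h x, t (g * h)%g x = t g (t h x).

Definition topologically_free :=
  forall g, g != 1%g -> [set x | t g x = x]° = set0.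

End group_action.

Definition preserves_class (R : realType) (X : ptopologicalType)
    (mu : {measure set (borelType X) -> \bar R}) (t : homeo X) :=
  pushforward mu (t : borelType X -> borelType X) `<< mu.

Section translation_Linfty.
Context {R : realType} {X : ptopologicalType} {E : normedModType R[i]}.
Variable mu : {measure set (borelType X) -> \bar R}.
Context {G : groupType} {t : G -> homeo X}.
Hypothesis tM : homeo_action t.
Hypothesis tmu : forall g, preserves_class mu (t g).

Lemma homeo_action1 x : t 1%g x = x.
Proof.
apply: (can_inj (homeo_funK (t 1%g))).
by rewrite -tM mulg1.
Qed.

Lemma homeo_invE g : homeo_inv (t g) =1 t g^-1%g.
Proof.
move=> x; apply: (can_inj (homeo_funK (t g))).
by rewrite homeo_invK -tM mulgV homeo_action1.
Qed.

Lemma borel_homeo g (A : set X) :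
  measurable (A : set (borelType X)) -> measurable (t g @^-1` A : set (borelType X)).
Proof.
move=> mA; rewrite -[_ @^-1` _]setTI.
suff : @measurable_fun _ _ (borelType X) (borelType X) setT (t g) by apply.
apply: measurability => //; move=> _ [B oB <-].
rewrite setTI; apply: sub_sigma_algebra.
by apply: open_comp => // x _; exact: homeo_fun_continuous.
Qed.

Lemma ae_homeo g (P : X -> Prop) :
  (\forall x \ae mu, P x) -> \forall x \ae mu, P (t g x).
Proof.
move=> [N [mN N0 PN]]; exists (t g @^-1` N); split.
- exact: borel_homeo.
- have /(tmu g) : mu.-null_set N by apply/measure0_null_setP.
  by apply.
- by move=> x /= Px; apply: PN.
Qed.

Lemma translation_norm g f :
  Linfty_norm mu (translation (t g) f : X -> E) = Linfty_norm mu f.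
Proof.
have le h k : (Linfty_norm mu (translation (t h) k : X -> E) <= Linfty_norm mu k)%E.
  apply/ess_supP; have := ess_sup_ge mu (fun x => (rnorm (k x))%:E).
  move=> /(ae_homeo h^-1%g); congr (almost_everywhere mu _).
  by apply/funext => x; rewrite /translation homeo_invE.
apply/eqP; rewrite eq_le le /=.
rewrite [X in (X <= _)%E](_ : _ = Linfty_norm mu (translation (t g^-1%g) (translation (t g) f))) ?le//.
congr (Linfty_norm mu _); apply/funext => x.
by rewrite /translation !homeo_invE -tM -invgM mulVg invg1 homeo_action1.
Qed.

Lemma translation_Linfty g f :
  Linfty mu f -> Linfty mu (translation (t g) f : X -> E).
Proof.
move=> [[s [ms sf]] foo]; split; last by rewrite translation_norm.
have fin n : finite_set (range (s n \o t g^-1%g)).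
  apply: sub_finite_set (fimfunP (s n)) => _ [x _ <-].
  by exists (t g^-1%g x).
pose s' n := HB.pack_for {fimfun borelType X >-> E} (s n \o t g^-1%g)
  (FiniteImage.Build _ _ _ (fin n)).
exists s'; split => [n e|].
  by rewrite comp_preimage; apply: borel_homeo; exact: ms.
move/(ae_homeo g^-1%g) : sf; congr (almost_everywhere mu _).
by apply/funext => x; rewrite /translation homeo_invE.
Qed.

End translation_Linfty.

Section families.
Context {R : realType} (I : Type) (E : normedModType R[i]).

Definition unit_ball_families : set (I -> E) :=
  [set f | forall g, rnorm (f g) <= 1].

Definition unit_sphere_families : set (I -> E) :=
  [set f | forall g, rnorm (f g) = 1].

End families.

Arguments unit_ball_families {R} I E.
Arguments unit_sphere_families {R} I E.

(* Main.v *)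
(** Every T_g is isometric and preserves null sets, so the operator norm is at
    most the supremum over ball families. A vector of norm at most 1 is a convex
    combination of u and -u for some unit vector u; since the norm of
    \sum_g a_g(x) f_g is convex in each f_g separately, unit spheres suffice.
    Conversely, fix x and a unit family f. On an open neighbourhood N of x the
    norm of \sum_g a_g(.) f_g stays close to its value at x. By topological
    freeness the points where t_g^-1 and t_h^-1 agree for some g != h in F form
    a finite union of closed sets with empty interior, so some y in N has
    distinct points t_g^-1(y), g in F. The simple function equal to f_g on a
    small neighbourhood of t_g^-1(y) is mapped to \sum_g a_g(.) f_g near y, that
    is, on a set of positive measure because mu has full support. *)
Require Import Defs.
From HB Require Import structures.
From mathcomp Require Import all_boot all_order all_algebra finmap.
From mathcomp Require Import complex.
From mathcomp Require Import all_classical all_reals all_analysis.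
From mathcomp Require Import ess_sup_inf.
From mathcomp Require Import ring lra.

Import Order.TTheory GRing.Theory Num.Theory.
Import numFieldNormedType.Exports.

Local Open Scope classical_set_scope.
Local Open Scope ring_scope.

(** * Point-set topology: coincidence sets, finite avoidance, separation *)

Lemma closed_equalizer {X Y : topologicalType} (f g : X -> Y) :
  hausdorff_space Y -> continuous f -> continuous g ->
  closed [set x | f x = g x].
Proof.
rewrite open_hausdorff => hY cf cg; rewrite -openC openE => x /= /eqP.
move=> /hY[[U V] /= [/set_mem Ux /set_mem Vx] [oU oV /eqP UV0]].
have : nbhs x (f @^-1` U `&` g @^-1` V).
  by apply: filterI; [apply: cf|apply: cg]; exact: open_nbhs_nbhs.
apply: filterS => y [/= Uy Vy] fgy.
by suff : set0 (f y); [|rewrite -UV0; split => //; rewrite fgy].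
Qed.

(** Removing one closed set with empty interior from a nonempty open set leaves a nonempty open set,
    so induction on the list suffices. *)
Lemma open_avoids_closed {X : topologicalType} {I : eqType} (s : seq I)
    (C : I -> set X) (U : set X) :
  (forall i, i \in s -> closed (C i) /\ (C i)° = set0) ->
  open U -> U !=set0 -> exists2 y, U y & forall i, i \in s -> ~ C i y.
Proof.
elim: s U => [|i s IHs] U sC oU U0; first by case: U0 => y Uy; exists y.
have [cCi Ci0] := sC i (mem_head i s).
have [|||y [Uy Ciy] sy] := IHs (U `&` ~` C i).
- by move=> j sj; apply: sC; rewrite inE sj orbT.
- by apply: openI => //; rewrite openC.
- apply/set0P/negP => /eqP UC0; case: U0 => y Uy.
  suff : (C i)° y by rewrite Ci0.
  suff UCi : U `<=` C i by move: Uy; rewrite (open_subsetE _ oU) in UCi; apply: UCi.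
  move=> z Uz; apply: contrapT => Ciz.
  by suff : set0 z by []; rewrite -UC0.
- by exists y => // j; rewrite inE => /predU1P[->|/sy].
Qed.

Lemma disjoint_open_nbhs {X : topologicalType} {I : finType} (p : I -> X) :
  hausdorff_space X -> injective p ->
  exists U : I -> set X,
    [/\ forall i, open (U i), forall i, U i (p i) & trivIset setT U].
Proof.
rewrite open_hausdorff => hX injp.
have : forall ij : I * I, exists AB : set X * set X, ij.1 != ij.2 ->
    [/\ nbhs (p ij.1) AB.1, nbhs (p ij.2) AB.2 & AB.1 `&` AB.2 = set0].
  move=> [i j] /=; have [->|ij] := eqVneq i j; first by exists (set0, set0).
  have /hX[[A B] /= [/set_mem Ai /set_mem Bj] [oA oB /eqP AB0]] : p i != p j.
    by apply: contra ij => /eqP /injp ->.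
  by exists (A, B) => _; split => //; exact: open_nbhs_nbhs.
move=> /choice[AB ABP].
(* The choice [AB] need not be symmetric in the pair, so [V i] obeys the constraints from both
   [(i, j)] and [(j, i)]. It is a neighbourhood of [p i] because [I] is finite. *)
pose V i := [set z | forall j, j != i -> (AB (i, j)).1 z /\ (AB (j, i)).2 z].
exists (fun i => (V i)°); split => [i|i|]; first exact: open_interior.
- apply: filter_forall => j.
  have [ji|ji] := eqVneq j i; first exact: filterE.
  have [|/= Ai _ _] := ABP (i, j); first by rewrite eq_sym.
  have [//|/= _ Bi _] := ABP (j, i).
  by apply: filterS2 Ai Bi => z Az Bz _.
- move=> i j _ _ [z [/interior_subset Vi /interior_subset Vj]].
  apply: contrapT => /eqP ij.
  have [//|/= _ _ AB0] := ABP (i, j).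
  have ji : j != i by rewrite eq_sym.
  have [Az _] := Vi j ji.
  have [_ Bz] := Vj i ij.
  by suff : set0 z by []; rewrite -AB0.
Qed.

(** * Continuity of operator-valued functions at fixed vectors *)

Section bounded_operators.
Context {R : realType}.
Implicit Types V W : normedModType R[i].

Lemma rnorm_le_rnormM {V W} (T : bounded_operator V W) v :
  rnorm (T v) <= rnorm T * rnorm v.
Proof.
have [->|v0] := eqVneq v 0.
  by rewrite -(scale0r (0 : V)) bo_scaleE !scale0r !rnorm0 mulr0.
have nv0 : 0 < rnorm v.
  rewrite lt_neqAle rnorm_ge0 andbT eq_sym.
  by apply: contra v0 => /eqP /rnorm0_eq0 ->.
have nV : complex.Re `|(rnorm v)^-1%:C%C| = (rnorm v)^-1.
  by rewrite ger0_norm// lecR invr_ge0 ltW.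
have := @rnorm_le_operator_norm _ _ _ T ((rnorm v)^-1%:C%C *: v).
rewrite bo_scaleE !rnormZ nV mulVf ?gt_eqF// lexx => /(_ isT).
by rewrite mulrC ler_pdivrMr.
Qed.

Lemma continuous_eval {X : topologicalType} {V W}
    (a : X -> bounded_operator V W) v :
  continuous a -> continuous (fun x => a x v).
Proof.
move=> ca x; apply/cvgrPdist_lt => e e0.
(* The added 1 keeps the divisor positive when [v] is 0. *)
have k0 : 0 < `|v| + 1 by rewrite ltr_wpDl.
have e'0 : 0 < e / (`|v| + 1) by rewrite divr_gt0.
move/cvgrPdist_lt : (ca x) => /(_ _ e'0); apply: filterS => y.
rewrite ltr_pdivlMr// => /(le_lt_trans _); apply.
have := rnorm_le_rnormM (a x - a y) v.
rewrite -lecR rmorphM /= !rnormE /= scaleN1r => /le_trans; apply.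
by rewrite ler_wpM2l// lerDl.
Qed.

Lemma bo_sum_near_gt {X : topologicalType} {V W} {I : finType}
    (a : I -> X -> bounded_operator V W) (f : I -> V) (x : X) (c : R) :
  (forall i, continuous (a i)) -> c < rnorm (\sum_i a i x (f i)) ->
  \forall y \near x, c < rnorm (\sum_i a i y (f i)).
Proof.
move=> ca; rewrite -ltcR rnormE => cx.
have cs : \sum_i a i y (f i) @[y --> x] --> \sum_i a i x (f i).
  apply: cvg_big => [|i _]; last exact: continuous_eval.
  by move=> z; apply: add_continuous.
apply: filterS (cvgr_norm_gt _ cs _ cx) => y.
by rewrite -rnormE ltcR.
Qed.

End bounded_operators.

(** * From unit balls to unit spheres *)

Section extreme_points.
Context {R : realType} {V W : normedModType R[i]}.
Hypothesis V0 : exists v : V, v != 0.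

Lemma exists_unit_multiple (v : V) :
  exists2 u : V, rnorm u = 1 & v = (rnorm v)%:C%C *: u.
Proof.
have unit (w : V) : w != 0 -> rnorm ((rnorm w)^-1%:C%C *: w) = 1.
  move=> w0; have nw0 : rnorm w != 0 by apply: contra w0 => /eqP/rnorm0_eq0 ->.
  by rewrite rnormZ ger0_norm ?lecR ?invr_ge0 ?rnorm_ge0//= mulVf.
have [->|v0] := eqVneq v 0.
  (* For [v = 0] any unit vector serves; [V0] provides one. *)
  case: V0 => w /unit u1; eexists; first exact: u1.
  by rewrite rnorm0 scale0r.
exists ((rnorm v)^-1%:C%C *: v); first exact: unit.
rewrite scalerA -rmorphM mulfV ?scale1r//.
by apply: contra v0 => /eqP /rnorm0_eq0 ->.
Qed.

(** With [v = r u], the left vector is a convex combination of [T u + w] and [T (- u) + w], one of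
    which is therefore at least as long. *)
Lemma unit_vector_dominates (T : bounded_operator V W) (v : V) (w : W) :
  rnorm v <= 1 ->
  exists2 u, rnorm u = 1 & rnorm (T v + w) <= rnorm (T u + w).
Proof.
move=> v1; have [u u1 vE] := exists_unit_multiple v.
set r := rnorm v in v1 vE; have r0 : 0 <= r := rnorm_ge0 v.
(* These weights solve [p + q = 1] and [p - q = r]. *)
pose p : R := (1 + r) / 2; pose q : R := (1 - r) / 2.
have p0 : 0 <= p by rewrite /p; lra.
have q0 : 0 <= q by rewrite /q; lra.
have pq : p + q = 1 by rewrite /p /q; field.
have TvE : T v + w = p%:C%C *: (T u + w) + q%:C%C *: (T (- 1 *: u) + w).
  rewrite vE !bo_scaleE !scalerDr scalerA addrACA -!scalerDl.
  rewrite mulrN1 -rmorphN -!rmorphD pq scale1r.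
  by congr (_%:C%C *: _ + _); rewrite /p /q; field.
have Nu1 : rnorm (- 1 *: u : V) = 1 by rewrite rnormZ normrN normr1 mul1r.
have : rnorm (T v + w) <= p * rnorm (T u + w) + q * rnorm (T (- 1 *: u) + w).
  rewrite TvE (le_trans (rnormD _ _))// !rnormZ.
  by rewrite !ger0_norm ?lecR.
have [uNu|/ltW Nuu] := leP (rnorm (T u + w)) (rnorm (T (- 1 *: u) + w)).
- by move=> le; exists (- 1 *: u) => //; nra.
- by move=> le; exists u => //; nra.
Qed.

(** Coordinates are replaced one at a time, the other summands being absorbed into the vector [w] of
    [unit_vector_dominates]. *)
Lemma unit_sphere_families_dominate {I : finType}
    (T : I -> bounded_operator V W) (f : I -> V) :
  unit_ball_families I V f ->
  exists2 f', unit_sphere_families I V f' &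
    rnorm (\sum_i T i (f i)) <= rnorm (\sum_i T i (f' i)).
Proof.
(* The invariant for the induction over [enum I]: coordinates already treated have norm 1, and all
   stay in the unit ball so that the next one can be treated. *)
move=> f1; suff [f' [_ f'1 lef']] : exists f', [/\ unit_ball_families I V f',
    forall i, i \in enum I -> rnorm (f' i) = 1 &
    rnorm (\sum_i T i (f i)) <= rnorm (\sum_i T i (f' i))].
  by exists f' => // i; apply: f'1; rewrite mem_enum.
elim: (enum I) => [|i s [h [h1 sh lefh]]]; first by exists f.
have [u u1 leu] := @unit_vector_dominates (T i) (h i)
  (\sum_(j | j != i) T j (h j)) (h1 i).
exists (fun j => if j == i then u else h j); split => [j|j|].
- by case: eqP => // _; rewrite u1.
- by rewrite inE; case: eqP => //= _; exact: sh.
- rewrite (le_trans lefh)// (bigD1 i)//= (le_trans leu)//.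
  rewrite [leRHS](_ : _ = rnorm (T i u + \sum_(j | j != i) T j (h j)))//.
  congr rnorm; rewrite (bigD1 i)//= eqxx; congr (_ + _).
  by apply: eq_bigr => j /negbTE ->.
Qed.

End extreme_points.

(** * Full support and simple test functions *)

Section support.
Context {R : realType} {X : ptopologicalType}.
Variable mu : {measure set (borelType X) -> \bar R}.

(** Otherwise the interior of [Q] would be a nonempty open set inside a null set. *)
Lemma ae_meets_nbhs (x : X) (P Q : set X) :
  measure_support mu = [set: X] ->
  (\forall y \ae mu, P y) -> nbhs x Q -> exists2 y, P y & Q y.
Proof.
move=> supp [N [mN N0 PN]] Qx; apply: contrapT => PQ.
have QN : Q° `<=` N.
  move=> y /interior_subset Qy; apply: PN => Py; apply: PQ.
  by exists y.
have : measure_support mu x by rewrite supp.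
move=> /(_ Q° (open_interior Q) Qx) /=; rewrite ltNge => /negP; apply.
rewrite -N0; apply: le_measure => //; rewrite inE//.
by apply: sub_sigma_algebra; exact: open_interior.
Qed.

Lemma Linfty_disjoint_open {E : normedModType R[i]} {I : finType}
    (U : I -> set X) (e : I -> E) :
  (forall i, open (U i)) -> trivIset setT U ->
  unit_ball_families I E e ->
  exists f : X -> E, [/\ Linfty mu f, (Linfty_norm mu f <= 1)%E &
    forall i x, U i x -> f x = e i].
Proof.
move=> oU tU e1.
(* The index of the set containing [x], or [None] outside all of them; [f] factors through this
   finite-valued map and is 0 on the [None] part. *)
pose h x : option I := [pick i | `[< U i x >]].
have hU i x : U i x -> h x = Some i.
  move=> Uix; rewrite /h; case: pickP => [j /asboolP Ujx|/(_ i)/asboolP//].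
  by congr Some; apply: tU => //; exists x.
have hSome i : h @^-1` [set Some i] = U i.
  apply/seteqP; split => [x /=|x /hU//].
  by rewrite /h; case: pickP => // j /asboolP Ujx [<-].
pose phi := oapp e 0; pose f x := phi (h x).
have mh i : measurable (h @^-1` [set i] : set (borelType X)).
  have mS j : measurable (h @^-1` [set Some j] : set (borelType X)).
    by rewrite hSome; exact: sub_sigma_algebra.
  case: i => [//|].
  rewrite (_ : _ @^-1` _ = ~` \bigcup_(j in [set: I]) h @^-1` [set Some j]).
    by apply: measurableC; apply: fin_bigcup_measurable.
  apply/seteqP; split => x /=.
    by move=> hx [j _ /=]; rewrite hx.
  by case hx: (h x) => [j|//] nU; exfalso; apply: nU; exists j.
have mf (A : set E) : measurable (f @^-1` A : set (borelType X)).
  rewrite (_ : _ @^-1` _ = \bigcup_(o in phi @^-1` A) h @^-1` [set o]).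
    by apply: fin_bigcup_measurable => // o _; exact: mh.
  by apply/seteqP; split => [x Ax|x [j Aj /= hj]]; [exists (h x)|rewrite /f /= hj].
have ff : finite_set (range (f : borelType X -> E)).
  apply: (@sub_finite_set _ _ (range phi)) => [_ [x _ <-]|]; first by exists (h x).
  by apply: finite_image; exact: finite_finset.
have f1 : (Linfty_norm mu f <= 1)%E.
  apply/ess_supP/aeW => x; rewrite lee_fin /f /phi.
  by case: (h x) => [i|] /=; [exact: e1|rewrite rnorm0].
exists f; split => //; last by move=> i x /hU hx; rewrite /f hx.
split; last by rewrite (le_lt_trans f1)// ltry.
(* Being measurable with finite range, [f] is approximated by the constant sequence [f]. *)
exists (fun=> HB.pack_for {fimfun borelType X >-> E} (f : borelType X -> E)
  (FiniteImage.Build _ _ _ ff)); split => [n y|]; first exact: mf.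
by apply/aeW => x; exact: cvg_cst.
Qed.

End support.

(** If the inverses of [t g] and [t h] agree at [y], then [y] is fixed by [t (g * h^-1)]. For
    [g != h] such fixed points form a closed set with empty interior, and there are finitely many
    pairs to avoid. *)
Lemma open_injective_orbit {X : ptopologicalType} {G : groupType}
    {t : G -> homeo X} (F : {fset G}) (U : set X) :
  hausdorff_space X -> homeo_action t -> topologically_free t ->
  open U -> U !=set0 ->
  exists2 y, U y & injective (fun g : F => homeo_inv (t (val g)) y).
Proof.
move=> hX tM tfree oU U0.
pose C (gh : F * F) := [set x | t (val gh.1 * (val gh.2)^-1)%g x = x].
have [|y Uy yC] := open_avoids_closed
    [seq gh <- enum {: F * F} | gh.1 != gh.2] C U _ oU U0.
  move=> [g h]; rewrite mem_filter => /andP[/= gh _]; split.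
    apply: (closed_equalizer _ idfun hX) => [|x]; last exact: cvg_id.
    exact: homeo_fun_continuous.
  apply: tfree; apply: contra gh => /eqP gh1; apply/eqP/val_inj.
  by rewrite -[LHS]mulg1 -(mulVg (val h)) mulgA gh1 mul1g.
exists y => // g h /= ghy; apply: contrapT => /eqP gh.
apply: (yC (g, h)); first by rewrite mem_filter gh mem_enum.
rewrite /C /= tM -(homeo_invE tM) -ghy.
by rewrite homeo_invK.
Qed.

(** * The two bounds for the operator norm *)

Section weighted_translations.
Context {R : realType} {X : ptopologicalType}.
Variable mu : {measure set (borelType X) -> \bar R}.
Context {E : normedModType R[i]} {G : groupType} {t : G -> homeo X}.
Variables (F : {fset G}) (a : F -> X -> bounded_operator E E).

Let S (f : X -> E) :=
  \sum_(g : F) multiplication (a g) (translation (t (val g)) f).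

Let SE f x : S f x = \sum_(g : F) a g x (f (homeo_inv (t (val g)) x)).
Proof. by rewrite /S fct_sumE. Qed.

Lemma Linfty_opnorm_le (M : \bar R) :
  homeo_action t -> (forall g, preserves_class mu (t g)) ->
  (forall x f, unit_ball_families F E f ->
    ((rnorm (\sum_(g : F) a g x (f g)))%:E <= M)%E) ->
  (Linfty_opnorm mu S <= M)%E.
Proof.
move=> tM tmu ball; apply: ge_ereal_sup => _ [f [_ f1] <-].
have aeF : Filter (almost_everywhere mu) := ae_filter_ringOfSetsType mu.
apply/ess_supP.
(* The exceptional null set of [f] is carried to a null set by each [g], and [F] is finite, so at
   almost every [x] the values of [f] entering [S f x] form a ball family. *)
have : \forall x \ae mu, forall g : F,
    rnorm (f (homeo_inv (t (val g)) x)) <= 1.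
  apply: filter_forall => g.
  have /(ae_homeo tmu (val g)^-1%g) : \forall x \ae mu, rnorm (f x) <= 1.
    by move/ess_supP : f1; apply: filterS => x; rewrite lee_fin.
  by apply: filterS => x; rewrite (homeo_invE tM).
by apply: filterS => x fx; rewrite SE; exact: ball.
Qed.

Lemma Linfty_opnorm_ge (x : X) (e : F -> E) :
  hausdorff_space X -> measure_support mu = [set: X] ->
  homeo_action t -> topologically_free t ->
  (forall g, continuous (a g)) -> unit_ball_families F E e ->
  ((rnorm (\sum_(g : F) a g x (e g)))%:E <= Linfty_opnorm mu S)%E.
Proof.
move=> hX supp tM tfree ca e1; apply/lee_subgt0Pr => d d0.
set r := rnorm _; rewrite -EFinB.
pose N := [set y | r - d < rnorm (\sum_(g : F) a g y (e g))].
have Nx : nbhs x N by apply: bo_sum_near_gt => //; rewrite ltrBlDr ltrDl.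
have [|y Ny yinj] := open_injective_orbit F _ hX tM tfree (open_interior N).
  by exists x.
have [U [oU Uy tU]] := disjoint_open_nbhs _ hX yinj.
have [f [fD f1 fU]] := Linfty_disjoint_open mu U e oU tU e1.
(* Near [y], the value of [f] at the inverse image of [z] under [t g] is exactly [e g], so [S f z]
   is the sum controlled by [N]. *)
have Wy : \forall z \near y, N z /\
    forall g : F, U g (homeo_inv (t (val g)) z).
  apply: filterI => //; apply: filter_forall => g.
  by apply: homeo_inv_continuous; exact: open_nbhs_nbhs.
apply: le_trans (ereal_sup_ubound _); last by exists f.
(* The essential supremum bounds the norm of [S f] only almost everywhere; full support yields a
   point near [y] where it does. *)
have [z /= Sz [Nz Uz]] := ae_meets_nbhs mu _ _ _ supp
  (ess_sup_ge mu (fun x => (rnorm (S f x))%:E)) Wy.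
apply: le_trans Sz; rewrite lee_fin SE.
under eq_bigr do rewrite (fU _ _ (Uz _)).
exact: ltW.
Qed.

End weighted_translations.

Theorem theorem6p2 (R : realType) (X : ptopologicalType)
  (crX : completely_regular_space X) (hX : hausdorff_space X)
  (mu : {measure set (borelType X) -> \bar R})
  (supp_mu : measure_support mu = [set: X])
  (E : completeNormedModType R[i]) (E0 : exists e : E, e != 0)
  (G : groupType) (t : G -> homeo X) (tM : homeo_action t)
  (tmu : forall g : G, preserves_class mu (t g))
  (tfree : topologically_free t)
  (F : {fset G}) (F0 : F != fset0)
  (a : F -> X -> bounded_operator E E)
  (a_cont : forall g : F, bounded_continuous (a g)) :
  Linfty_opnorm mu
      (fun f => \sum_(g : F) multiplication (a g) (translation (t (val g)) f))
    = ereal_sup [set ereal_sup [set (rnorm (\sum_(g : F) a g x (f g)))%:E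
                                 | f in unit_sphere_families F E]
                  | x in [set: X]]
  /\
  ereal_sup [set ereal_sup [set (rnorm (\sum_(g : F) a g x (f g)))%:E
                                 | f in unit_sphere_families F E]
                  | x in [set: X]]
    = ereal_sup [set ereal_sup [set (rnorm (\sum_(g : F) a g x (f g)))%:E
                                 | f in unit_ball_families F E]
                  | x in [set: X]].
Proof.
set L := Linfty_opnorm _ _; set S := ereal_sup _; set B := ereal_sup _.
have SB : (S <= B)%E.
  apply: ge_ereal_sup => _ [x _ <-]; apply: ge_ereal_sup => _ [f f1 <-].
  apply: (le_trans _ (ereal_sup_ubound _)); last by exists x.
  by apply: ereal_sup_ubound; exists f => // g; rewrite f1.
(* This estimate serves twice: for [B <= S], and as the hypothesis of [Linfty_opnorm_le] with [M]
   equal to [S]. *)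
have ballS x f : unit_ball_families F E f ->
    ((rnorm (\sum_(g : F) a g x (f g)))%:E <= S)%E.
  move=> /(unit_sphere_families_dominate E0 (a^~ x))[f' f'1 le].
  apply: (@le_trans _ _ (rnorm (\sum_(g : F) a g x (f' g)))%:E).
    by rewrite lee_fin.
  apply: (le_trans _ (ereal_sup_ubound _)); last by exists x.
  by apply: ereal_sup_ubound; exists f'.
have BS : (B <= S)%E.
  apply: ge_ereal_sup => _ [x _ <-]; apply: ge_ereal_sup => _ [f f1 <-].
  exact: ballS.
split; apply/eqP; rewrite eq_le; last by rewrite SB BS.
apply/andP; split; first exact: Linfty_opnorm_le.
apply: ge_ereal_sup => _ [x _ <-]; apply: ge_ereal_sup => _ [f f1 <-].
apply: Linfty_opnorm_ge => // g; first by case: (a_cont g).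
by rewrite f1.
Qed.
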